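(* As $m$ and $k$ both tend to infinity (with no assumption on the relation between them), $$ch(K_{m*k})=(1+o(1))\,k\ln m,$$ i.e. for every $\varepsilon>0$ there is $N$ such that for all integers $m,k\ge N$, $(1-\varepsilon)k\ln m\le ch(K_{m*k})\le(1+\varepsilon)k\ln m$.
   Context: $K_{m*k}$ denotes the complete $k$-partite graph with $k$ color classes, each of size $m$. The choice number $ch(G)$ of a graph $G$ is the smallest integer $s$ such that for every assignment of a list of $s$ colors to each vertex of $G$ there is a proper coloring of $G$ assigning to each vertex a color from its list. *)

(* Defs.v *)
From HB Require Import structures.
From mathcomp Require Import all_boot all_order all_algebra.
From mathcomp Require Import boolp reals exp.

Set Implicit Arguments.
Unset Strict Implicit.
Unset Printing Implicit Defensive.

Record sgraph := SGraph {
  vertex :> finType;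
  adj : rel vertex;
  adj_sym : symmetric adj;
  adj_irrefl : irreflexive adj }.

Definition proper_coloring (G : sgraph) (C : finType) (c : G -> C) : Prop :=
  forall u v : G, adj u v -> c u <> c v.

(* Finitely many lists of finite size use finitely many colors in total, so
   letting the color set C range over all finite types is no restriction. *)
Definition choosable (G : sgraph) (s : nat) : Prop :=
  forall (C : finType) (L : G -> {set C}), (forall v, #|L v| = s) ->
  exists c : G -> C, (forall v, c v \in L v) /\ proper_coloring c.

Lemma choosable_card (G : sgraph) : choosable G #|G|.
Proof.
move=> C L Ls.
suff [c [cL cI]] : exists c : G -> C,
    (forall v, c v \in L v) /\ {in enum G &, injective c}.
  exists c; split=> // u v uv cuv; move: uv.
  by rewrite (cI u v) ?mem_enum // adj_irrefl.
have : size (enum G) <= #|G| by rewrite -cardE.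
elim: (enum G) (enum_uniq G) => [_ _|v s IH /= /andP[vs us] szs].
  have L0 v : exists x, x \in L v.
    by apply/card_gt0P; rewrite Ls; apply/card_gt0P; exists v.
  by exists (fun v => xchoose (L0 v)); split=> // v; exact: xchooseP.
have [c [cL cI]] := IH us (ltnW szs).
have [x xL xs] : exists2 x, x \in L v & x \notin map c s.
  apply/subsetPn; apply/negP => /subset_leq_card; rewrite Ls => le.
  by have := leq_trans le (card_size _); rewrite size_map leqNgt szs.
exists (fun u => if u == v then x else c u); split=> [u|].
  by case: eqP => [->|].
move=> u w; rewrite !inE; case: eqVneq => [->|_] /=.
  by case: eqVneq => [->|_] //= _ ws E; case/negP: xs; rewrite E map_f.
move=> us'; case: eqVneq => [->|_] /=; last exact: cI.
by move=> _ E; case/negP: xs; rewrite -E map_f.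
Qed.

Lemma ex_choosable (G : sgraph) : exists s, `[< choosable G s >].
Proof. by exists #|G|; apply/asboolP; exact: choosable_card. Qed.

Definition ch (G : sgraph) : nat := ex_minn (ex_choosable G).

Section CompleteMultipartite.
Variables m k : nat.

(* The vertex (i, j) is the j-th vertex of the i-th color class. *)
Definition Kmk_adj : rel ('I_k * 'I_m)%type := fun u v => u.1 != v.1.

Fact Kmk_sym : symmetric Kmk_adj.
Proof. by move=> u v; rewrite /Kmk_adj eq_sym. Qed.

Fact Kmk_irrefl : irreflexive Kmk_adj.
Proof. by move=> u; rewrite /Kmk_adj eqxx. Qed.

Definition Kmk : sgraph := SGraph Kmk_sym Kmk_irrefl.

End CompleteMultipartite.

(* Main.v *)
Require Import Defs.
From HB Require Import structures.
From mathcomp Require Import all_boot all_order all_algebra.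
From mathcomp Require Import boolp reals exp.
From mathcomp Require Import sequences zify ring lra.

Import Order.TTheory GRing.Theory Num.Theory.
Local Open Scope ring_scope.

(* Upper bound: for bounded k, send every color to a uniformly random color
   class; the union bound over the m * k vertices succeeds as soon as lists have
   (1 + e) k ln m colors. For large k, split the color classes into four groups
   and the colors into four random parts; by a Chernoff bound every list keeps
   nearly a quarter of its colors in the part of its group. Starting from a
   bounded number q of classes, lists of size D (4^j (H + 1) - 3^j) suffice for
   4^j q classes: the margin D 3^j / 4 in step j beats the deviations because
   9^j / 4^j grows, while 3^j is negligible against 4^j H.

   Lower bound: for fixed K, a random family of m subsets of size
   s ~ (1 - e) K ln m of a set of K s colors has no transversal of size s.
   Replace each color by r = k / K copies and give this same family to all k
   color classes: a proper coloring would yield k disjoint transversals, each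
   with more than s colors, among only r K s colors. *)

(** * Choosability under changes of list size and number of classes *)

Lemma choosable_ge (G : sgraph) (s : nat) (C : finType) (L : G -> {set C}) :
  choosable G s -> (forall v, (s <= #|L v|)%N) ->
  exists c : G -> C, (forall v, c v \in L v) /\ proper_coloring c.
Proof.
move=> Gs sL; pose L' v := [set x in take s (enum (L v))].
have sz v : size (take s (enum (L v))) = s.
  by rewrite size_takel // -cardE.
have cL' v : #|L' v| = s.
  rewrite cardsE (card_uniqP _) ?sz //.
  exact: take_uniq (enum_uniq _).
have [c [cL cP]] := Gs C L' cL'.
exists c; split=> // v.
by have := cL v; rewrite inE => /mem_take; rewrite mem_enum.
Qed.

Lemma leq_choosable (G : sgraph) (s t : nat) :
  (s <= t)%N -> choosable G s -> choosable G t.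
Proof.
by move=> st Gs C L Lt; apply: choosable_ge Gs _ => v; rewrite Lt.
Qed.

Lemma ch_leP (G : sgraph) (s : nat) : choosable G s <-> (ch G <= s)%N.
Proof.
rewrite /ch; case: ex_minnP => n /asboolP Gn nP; split=> [Gs|ns].
  by apply: nP; apply/asboolP.
exact: leq_choosable ns Gn.
Qed.

Lemma Kmk_choosable_leq (m k k' s : nat) :
  (k <= k')%N -> choosable (Kmk m k') s -> choosable (Kmk m k) s.
Proof.
case: k => [_ _ C L _|k kk' Gs C L Ls].
  have F (v : Kmk m 0) : False by case: v => [[]].
  by exists (fun v => False_rect _ (F v)); split=> v; case: (F v).
(* Classes outside the smaller graph receive the lists of class 0. *)
pose L' (v : Kmk m k') := L (insubd ord0 (val v.1), v.2).
have [c [cL cP]] := Gs C L' (fun v => Ls _).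
exists (fun v => c (widen_ord kk' v.1, v.2)); split=> [[i j]|u v uv].
  by have := cL (widen_ord kk' i, j); rewrite /L' /= valKd.
by apply: cP; apply: contra uv => /eqP/(congr1 val)/= /val_inj/eqP.
Qed.

Lemma Kmk1_choosable (m : nat) : choosable (Kmk m 1) 1.
Proof.
move=> C L L1.
have L0 v : exists x, x \in L v by apply/card_gt0P; rewrite L1.
exists (fun v => xchoose (L0 v)); split=> [v|u v]; first exact: xchooseP.
by rewrite /= /Kmk_adj !ord1 eqxx.
Qed.

(** * Random splitting of the colors into parts *)

(* The generating function of the number of points of L sent to b by a
   uniformly random map. *)
Lemma sum_exp_fiber (R : comNzRingType) (C : finType) (p : nat) (L : {set C})
    (b : 'I_p) (x : R) :
  \sum_(f : {ffun C -> 'I_p}) x ^+ #|[set c in L | f c == b]| =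
  (p.-1%:R + x) ^+ #|L| * p%:R ^+ (#|C| - #|L|).
Proof.
pose w c (i : 'I_p) := if (c \in L) && (i == b) then x else 1.
transitivity (\sum_(f : {ffun C -> 'I_p}) \prod_c w c (f c)).
  apply: eq_bigr => f _; rewrite /w -big_mkcond prodr_const /=.
  by congr (_ ^+ _); apply: eq_card => c; rewrite !inE.
(* By distributivity each color contributes its own factor: [p.-1 + x] inside [L], [p] outside. *)
rewrite -bigA_distr_bigA (bigID [in L]) /=; congr (_ * _).
  rewrite -prodr_const; apply: eq_bigr => c cL.
  rewrite (bigD1 b) //= /w cL eqxx addrC; congr (_ + _).
  rewrite (eq_bigr (fun=> 1)) => [|i /negPf -> //].
  by rewrite sumr_const cardC1 card_ord.
have -> : (#|C| - #|L|)%N = #|~: L| by rewrite [RHS]cardsCs setCK.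
rewrite -prodr_const; apply: eq_big => [c|c /negPf cL]; first by rewrite inE.
rewrite (eq_bigr (fun=> 1)) => [|i _]; first by rewrite sumr_const card_ord.
by rewrite /w cL.
Qed.

(* A list is bad for f when it keeps at most s colors in its part; for such f
   the weight x ^ (number of kept colors) is at least x ^ s. For s = 0, x = 0
   (with 0 ^ 0 = 1) this is the plain union bound. *)
Lemma choosable_split (R : realFieldType) (m k p s t : nat) (x : R) :
  0 <= x <= 1 -> (0 < p)%N -> choosable (Kmk m k) s.+1 ->
  (p * k * m)%:R * ((p.-1%:R + x) / p%:R) ^+ t < x ^+ s ->
  choosable (Kmk m (p * k)) t.
Proof.
move=> /andP[x0 x1] p0 Gs bnd C L Lt.
have gP (i : 'I_(p * k)) : (i %% p < p)%N by rewrite ltn_mod.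
have hP (i : 'I_(p * k)) : (i %/ p < k)%N by rewrite ltn_divLR // [ltnRHS]mulnC.
have iP (b : 'I_p) (i : 'I_k) : (i * p + b < p * k)%N.
  rewrite [ltnRHS]mulnC; apply: (@leq_trans (i.+1 * p)); last by rewrite leq_mul2r ltn_ord orbT.
  by rewrite mulSn addnC ltn_add2r.
pose grp (v : Kmk m (p * k)) : 'I_p := Ordinal (gP v.1).
pose hit (f : {ffun C -> 'I_p}) v := [set c in L v | f c == grp v].
have [f fP] : exists f, [forall v, (s < #|hit f v|)%N].
  (* If every [f] had a bad vertex, the total weight of each [f] would be at least [x ^ s],
     contradicting the average given by the generating function. *)
  apply/existsP; apply: contraT; rewrite negb_exists => /forallP bad.
  have: \sum_(f : {ffun C -> 'I_p}) x ^+ s <=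
        \sum_(f : {ffun C -> 'I_p}) \sum_v x ^+ #|hit f v|.
    apply: ler_sum => f _; have /forallPn[v] := bad f; rewrite -leqNgt => lev.
    rewrite (bigD1 v) //= -[leLHS]addr0 lerD ?sumr_ge0 // => [|w _].
      exact: ler_wiXn2l.
    exact: exprn_ge0.
  rewrite exchange_big /= sumr_const card_ffun card_ord.
  have E v : \sum_(f : {ffun C -> 'I_p}) x ^+ #|hit f v| =
      ((p.-1%:R + x) / p%:R) ^+ t * p%:R ^+ #|C|.
    rewrite sum_exp_fiber Lt -(subnK (max_card [in L v])) Lt exprD.
    by rewrite addnK expr_div_n mulrACA mulVf ?mulr1 // expf_neq0 // pnatr_eq0 -lt0n.
  rewrite (eq_bigr _ (fun v _ => E v)) sumr_const card_prod !card_ord.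
  rewrite -(mulr_natl (_ ^+ s)) -(mulr_natl (_ * _)) mulrA natrX mulrC.
  by rewrite ler_pM2r ?exprn_gt0 ?ltr0n // leNgt bnd.
pose L' b (v : Kmk m k) :=
  [set c in L (Ordinal (iP b v.1), v.2) | f c == b].
have colP b : exists c : Kmk m k -> C,
    (forall v, c v \in L' b v) /\ proper_coloring c.
  apply: choosable_ge Gs _ => v.
  have /= := forallP fP (Ordinal (iP b v.1), v.2).
  rewrite /hit /L'; congr (_ < #|pred_of_set _|)%N; apply/setP => c; rewrite !inE.
  by congr (_ && (_ == _)); apply: val_inj; rewrite /= modnMDl modn_small.
pose col b := sval (cid (colP b)).
pose low (v : Kmk m (p * k)) : Kmk m k := (Ordinal (hP v.1), v.2).
have cvL' v : col (grp v) (low v) \in L' (grp v) (low v).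
  by rewrite /col; case: cid => c [/= cL _]; apply: cL.
exists (fun v => col (grp v) (low v)); split=> [v|u v uv].
  have := cvL' v; rewrite inE => /andP[+ _]; congr (_ \in L _).
  by case: v => i j; congr (_, _); apply: val_inj; rewrite /= -divn_eq.
(* Within a group the coloring of that group is proper; different groups use different parts of the
   colors. *)
case: (eqVneq (grp u) (grp v)) => [guv|guv E].
  rewrite guv /col; case: cid => c [/= _]; apply; apply: contra uv.
  move=> /eqP/(congr1 val)/= duv; apply/eqP/val_inj.
  by rewrite /= (divn_eq u.1 p) (divn_eq v.1 p) duv; move/(congr1 val): guv => /= ->.
have := cvL' u; have := cvL' v; rewrite !inE => /andP[_ /eqP fv] /andP[_ /eqP fu].
by case/eqP: guv; rewrite -fu -fv E.
Qed.

(** * Families of sets without small transversals *)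

Lemma card_disjoint_draws (T : finType) (A : {set T}) (s : nat) :
  #|[set B : {set T} | (#|B| == s) && [disjoint B & A]]| = 'C(#|T| - #|A|, s).
Proof.
have -> : (#|T| - #|A|)%N = #|~: A| by rewrite [RHS]cardsCs setCK.
rewrite -cards_draws; apply: eq_card => B.
by rewrite !inE andbC subsets_disjoint setCK.
Qed.

(** A union bound by counting: for each of the at most [2 ^ #|C|] sets [T], the families whose
    members all meet [T] are at most the [m]-th power of ['C(#|C|, s) - 'C(#|C| - u, s)]. *)
Lemma avoiding_family (C : finType) (m s u : nat) :
  (2 ^ #|C| * ('C(#|C|, s) - 'C(#|C| - u, s)) ^ m < 'C(#|C|, s) ^ m)%N ->
  exists F : 'I_m -> {set C}, (forall j, #|F j| = s) /\
    forall T : {set C}, (#|T| <= u)%N -> exists j, [disjoint F j & T].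
Proof.
move=> lt.
pose D := [set B : {set C} | #|B| == s].
pose E (T : {set C}) := [set B in D | ~~ [disjoint B & T]].
have cE (T : {set C}) : (#|T| <= u)%N -> (#|E T| <= 'C(#|C|, s) - 'C(#|C| - u, s))%N.
  move=> Tu.
  have := cardsID [set B : {set C} | [disjoint B & T]] D.
  have -> : D :\: [set B : {set C} | [disjoint B & T]] = E T.
    by apply/setP => B; rewrite !inE andbC.
  have -> : #|D :&: [set B : {set C} | [disjoint B & T]]| = 'C(#|C| - #|T|, s).
    rewrite -card_disjoint_draws; apply: eq_card => B; by rewrite !inE.
  rewrite card_draws => <-.
  have le : ('C(#|C| - u, s) <= 'C(#|C| - #|T|, s))%N by rewrite leq_bin2l ?leq_sub2l.
  by rewrite -addnBAC // leq_addl.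
pose badF (T : {set C}) := [set F : {ffun 'I_m -> {set C}} in ffun_on [in E T]].
pose U := \bigcup_(T : {set C} | (#|T| <= u)%N) badF T.
have cU : (#|U| <= 2 ^ #|C| * ('C(#|C|, s) - 'C(#|C| - u, s)) ^ m)%N.
  apply: (@leq_trans (\sum_(T : {set C} | (#|T| <= u)%N) #|badF T|)).
    rewrite /U; elim/big_rec2: _ => [|T n A _ le]; first by rewrite cards0.
    by apply: leq_trans (leq_card_setU _ _) _; rewrite leq_add2l.
  apply: (@leq_trans (\sum_(T : {set C})
      ('C(#|C|, s) - 'C(#|C| - u, s)) ^ m)).
    rewrite [leqRHS](bigID (fun T : {set C} => (#|T| <= u)%N)) /=.
    apply: leq_trans (leq_addr _ _); apply: leq_sum => T Tu.
    rewrite cardsE card_ffun_on card_ord.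
    by case: (posnP m) => [->|m0] //; rewrite leq_exp2r ?cE.
  by rewrite sum_nat_const -[X in (X * _)%N]cardsT -powersetT card_powerset cardsT.
have [F FD FU] : exists2 F : {ffun 'I_m -> {set C}}, F \in ffun_on [in D] & F \notin U.
  apply/subsetPn; apply/negP => /subset_leq_card.
  rewrite card_ffun_on card_ord card_draws leqNgt.
  by rewrite (leq_ltn_trans cU lt).
have Fs j : #|F j| = s by have /ffun_onP/(_ j) := FD; rewrite inE => /eqP.
exists F; split=> // T Tu; apply/existsP; apply: contraR FU.
rewrite negb_exists => /forallP FT; apply/bigcupP; exists T => //.
by rewrite inE; apply/ffun_onP => j; rewrite !inE Fs eqxx FT.
Qed.

(** Each class uses at least [u.+1] color copies and each copy serves at most one class, so
    [k * u.+1 <= #|C| * r], which is too small. *)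
Lemma not_choosable_blowup (C : finType) (m s u K r k : nat)
    (F : 'I_m -> {set C}) :
  (forall j, #|F j| = s) ->
  (forall T : {set C}, (#|T| <= u)%N -> exists j, [disjoint F j & T]) ->
  (#|C| < K * u.+1)%N -> (0 < r)%N -> (r * K <= k)%N ->
  ~ choosable (Kmk m k) (r * s).
Proof.
move=> Fs FT CK r0 rk ch.
pose L (v : Kmk m k) : {set C * 'I_r} := setX (F v.2) setT.
have Ls v : #|L v| = (r * s)%N by rewrite cardsX Fs cardsT card_ord mulnC.
have [c [cL cP]] := ch _ L Ls.
pose T i := [set c (i, j) | j : 'I_m].
have Tu i : (u < #|T i|)%N.
  rewrite ltnNge; apply/negP => Tle.
  have [|j] := FT [set x.1 | x in T i].
    exact: leq_trans (leq_imset_card _ _) Tle.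
  move=> /pred0P/(_ (c (i, j)).1)/=/negP; apply; apply/andP; split.
    by have := cL (i, j); rewrite !inE => /andP[].
  by rewrite imset_f // imset_f.
have disj x : (\sum_(i < k) (x \in T i) <= 1)%N.
  rewrite -big_mkcond sum1_card; apply/card_le1_eqP => i i'.
  rewrite !unfold_in => /imsetP[j _ xj] /imsetP[j' _ xj'].
  apply/eqP; apply: contraT => ii'.
  by case: (cP (i', j') (i, j) ii'); rewrite -xj.
have le1 : (k * u.+1 <= #|C| * r)%N.
  apply: (@leq_trans (\sum_(i < k) #|T i|)).
    by rewrite -[X in (X * _)%N]card_ord -sum_nat_const leq_sum.
  under eq_bigr => i _ do rewrite -sum1_card big_mkcond /=.
  rewrite exchange_big /= -[X in (_ * X)%N]card_ord -card_prod -[leqRHS]sum1_card.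
  by apply: leq_sum => x _; apply: disj.
have := leq_mul rk (leqnn u.+1); rewrite leqNgt => /negP[].
apply: leq_ltn_trans le1 _.
by rewrite mulnC -mulnA ltn_pmul2l.
Qed.

(** * Estimates for binomials, exponentials and logarithms *)

(** Bounds from below the probability that a random [s]-subset of [s * q.+2] colors misses [s] given
    ones. The factors of the falling factorials compare one by one, with difference [s - i]. *)
Lemma bin_avoid_ratio (q s : nat) :
  (q ^ s * 'C(s * q.+2, s) <= q.+1 ^ s * 'C(s * q.+1, s))%N.
Proof.
rewrite -(leq_pmul2r (fact_gt0 s)) -!mulnA !bin_ffact !ffact_prod.
have E a : (a ^ s = \prod_(i < s) a)%N by rewrite prod_nat_const card_ord.
rewrite !E -!big_split /=.
by apply: leq_prod => i _; have := ltn_ord i; nia.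
Qed.

(** The inequality [1 + z <= expR z] at [z = y / (1 - y)], inverted. *)
Lemma expR_le_1B (R : realType) (y : R) : y < 1 -> expR (- (y / (1 - y))) <= 1 - y.
Proof.
move=> y1; have y0 : 0 < 1 - y by lra.
have := expR_ge1Dx (y / (1 - y)).
rewrite expRN -[X in _ -> _ <= X]invrK lef_pV2 ?posrE ?invr_gt0 ?expR_gt0 //.
by congr (_ <= _); field; lra.
Qed.

Lemma expR_le_1B_half (R : realType) (y : R) :
  0 <= y <= 1/2 -> expR (- (y + 2 * y ^+ 2)) <= 1 - y.
Proof.
move=> /andP[y0 y1]; apply: le_trans (expR_le_1B _ y _); last by lra.
rewrite ler_expR lerN2 ler_pdivrMr; last by lra.
nra.
Qed.

Lemma ex_natr_gt (R : realType) (x : R) : exists n : nat, x < n%:R.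
Proof.
exists (Num.truncn `|x|).+1.
have /andP[_] := truncn_itv (normr_ge0 x).
exact/le_lt_trans/ler_norm.
Qed.

Lemma ex_natr_itv (R : realType) (x : R) :
  0 <= x -> exists n : nat, n%:R <= x < n%:R + 1.
Proof. by move=> /truncn_itv; rewrite -natr1; exists (Num.truncn x). Qed.

Lemma near_ln_ge (R : realType) (B : R) :
  exists N : nat, forall m, (N <= m)%N -> B <= ln (m%:R : R).
Proof.
have [N ltB] := ex_natr_gt _ (expR B); exists N => m Nm.
have Bm : expR B <= m%:R by rewrite (le_trans (ltW ltB)) // ler_nat.
by rewrite -ler_expR lnK // posrE (lt_le_trans (expR_gt0 B)).
Qed.

(** * The lower bound *)

(** With [n = s * q.+2] colors and [p = (q / q.+1) ^ s], the union bound is at most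
    [2 ^ n * (1 - p) ^ m <= expR (n - m * p)]; the hypothesis says [n < m * p]. *)
Lemma Kmk_not_choosable (R : realType) (m k q r s : nat) :
  (s * q.+2)%:R < m%:R * (q%:R / q.+1%:R) ^+ s :> R ->
  (0 < r)%N -> (r * q.+2 <= k)%N -> ~ choosable (Kmk m k) (r * s).
Proof.
move=> lt r0 rk.
pose n := (s * q.+2)%N.
have sn : (s <= n)%N by rewrite leq_pmulr.
have N0 : (0 < 'C(n, s))%N by rewrite bin_gt0.
have [F [Fs FT]] : exists F : 'I_m -> {set 'I_n}, (forall j, #|F j| = s) /\
    forall T : {set 'I_n}, (#|T| <= s)%N -> exists j, [disjoint F j & T].
  apply: avoiding_family; rewrite card_ord.
  have -> : (n - s = s * q.+1)%N by rewrite /n mulnS addKn.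
  set N := 'C(n, s) in N0 *; set a := 'C(_, _).
  have aN : (a <= N)%N by rewrite leq_bin2l // /n leq_mul2l leqnSn orbT.
  rewrite -(ltr_nat R) natrM !natrX natrB //.
  set p := (q%:R / q.+1%:R) ^+ s in lt.
  have pa : N%:R * p <= a%:R.
    rewrite /p expr_div_n mulrA ler_pdivrMr ?exprn_gt0 ?ltr0n //.
    rewrite -!natrX -!natrM ler_nat mulnC [leqRHS]mulnC.
    exact: bin_avoid_ratio.
  have le : (N%:R - a%:R) ^+ m <= N%:R ^+ m * expR (- (m%:R * p)).
    rewrite -mulrN expRM_natl -exprMn; apply: lerXn2r.
    - by rewrite nnegrE subr_ge0 ler_nat.
    - by rewrite nnegrE mulr_ge0 ?expR_ge0.
    apply: (@le_trans _ _ (N%:R * (1 - p))); first by lra.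
    by rewrite ler_wpM2l // expR_ge1Dx.
  apply: le_lt_trans (ler_wpM2l _ le) _; first exact: exprn_ge0.
  rewrite mulrCA -[ltRHS]mulr1 ltr_pM2l ?exprn_gt0 ?ltr0n //.
  have le2 : 2 ^+ n <= expR n%:R :> R.
    rewrite -[n%:R]mulr1 expRM_natl lerXn2r ?nnegrE ?expR_ge0 //.
    by have := expR_ge1Dx (1 : R).
  apply: le_lt_trans (ler_wpM2r (expR_ge0 _) le2) _.
  by rewrite -expRD expR_lt1 subr_lt0.
apply: (@not_choosable_blowup _ _ _ _ q.+2 _ _ _ Fs FT) => //.
rewrite card_ord /n; lia.
Qed.

Lemma ch_lower (R : realType) (e : R) : 0 < e <= 1 / 4 ->
  exists N : nat, forall m k : nat, (N <= m)%N -> (N <= k)%N ->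
    (1 - 4 * e) * (k%:R * ln (m%:R : R)) <= (ch (Kmk m k))%:R.
Proof.
move=> /andP[e0 e1].
have [q] := ex_natr_gt _ (2 / e).
have [Q qQ] : exists Q : R, q%:R = Q by exists q%:R.
have [K qK] : exists K : R, q.+2%:R = K by exists q.+2%:R.
have KQ : K = Q + 2 by rewrite -qK -qQ -natr1 -natr1; ring.
rewrite qQ => Qe.
have Q1 : 1 <= Q.
  rewrite -qQ ler1n -(ltr_nat R) qQ; apply: lt_trans Qe; exact: divr_gt0.
have K0 : 0 < K by lra.
have eQ : 0 < e * Q by rewrite mulr_gt0 //; lra.
(* For [l = ln m], the first summand gives [K ^+ 2 * l < (e * l / 2) ^+ 2]; the second gives
   [1 < e * Q * l], which absorbs the rounding of [s]. *)
have [N1 N1P] := near_ln_ge _ (4 * K ^+ 2 / e ^+ 2 + 1 / (e * Q)).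
have [N2 N2P] := ex_natr_gt _ (K / e).
exists (N1 + N2 + q.+2)%N => m k mN kN.
have l12 : 4 * K ^+ 2 / e ^+ 2 + 1 / (e * Q) <= ln (m%:R : R).
  by apply: N1P; apply: leq_trans mN; rewrite -addnA leq_addr.
have m0 : (0 < m)%N by apply: leq_trans mN; rewrite addnS.
have kK : K / e < k%:R.
  apply: lt_le_trans N2P _; rewrite ler_nat; apply: leq_trans kN.
  by rewrite addnAC leq_addl.
have kq : (q.+2 <= k)%N by apply: leq_trans kN; rewrite leq_addl.
have ml : m%:R = expR (ln (m%:R : R)) by rewrite lnK // posrE ltr0n.
move: (ln _) l12 ml => l l12 ml.
have l1 : 4 * K ^+ 2 / e ^+ 2 < l.
  by have : 0 < 1 / (e * Q); [exact: divr_gt0 | lra].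
have l2 : 1 / (e * Q) < l.
  have : 0 < 4 * K ^+ 2 / e ^+ 2; last by lra.
  by rewrite divr_gt0 ?mulr_gt0 ?exprn_gt0.
have l0 : 0 < l by apply: lt_trans l2; exact: divr_gt0.
have [s /andP[s1 s2]] : exists s : nat, s%:R <= (1 - e) * Q * l < s%:R + 1.
  by apply: ex_natr_itv; rewrite !mulr_ge0 //; lra.
have [r [rK r0 rk]] : exists r, [/\ (r * q.+2 <= k)%N, (0 < r)%N &
    k%:R < (r%:R + 1) * K].
  exists (k %/ q.+2)%N; split; first exact: leq_divM.
    by rewrite divn_gt0.
  by rewrite natr1 -qK -natrM ltr_nat ltn_ceil.
have nch : ~ choosable (Kmk m k) (r * s).
  apply: (@Kmk_not_choosable R _ _ q) => //.
  have p1 : expR (- ((1 - e) * l)) <= (q%:R / q.+1%:R) ^+ s.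
    have -> : q%:R / q.+1%:R = 1 - (Q + 1)^-1.
      by rewrite -natr1 qQ; field; lra.
    have y1 : (Q + 1)^-1 < 1 by rewrite invf_lt1; lra.
    apply: le_trans (lerXn2r s _ _ (expR_le_1B R _ y1)); rewrite ?nnegrE ?expR_ge0 //; last by lra.
    rewrite -expRM_natl ler_expR mulrN lerN2.
    have -> : (Q + 1)^-1 / (1 - (Q + 1)^-1) = Q^-1 by field; lra.
    rewrite ler_pdivrMr; last by lra.
    by apply: le_trans s1 _; rewrite mulrAC.
  apply: (@lt_le_trans _ _ (expR (e * l))); last first.
    apply: (@le_trans _ _ (m%:R * expR (- ((1 - e) * l)))); last by rewrite ler_wpM2l.
    by rewrite ml -expRD ler_expR -[X in X - _]mul1r -mulrBl opprB addrC subrK.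
  have sl : s%:R <= K * l.
    apply: le_trans s1 _; rewrite ler_wpM2r ?(ltW l0) //.
    by rewrite mulrBl mul1r KQ; lra.
  (* Squaring [1 + e * l / 2 <= expR (e * l / 2)] gives a bound quadratic in [l], which beats
     [s * K <= K ^+ 2 * l]. *)
  have -> : e * l = 2%:R * (e * l / 2) by field.
  rewrite expRM_natl.
  apply: (@lt_le_trans _ _ ((1 + e * l / 2) ^+ 2)); last first.
    apply: lerXn2r; rewrite ?nnegrE ?expR_ge0 ?expR_ge1Dx //.
    by rewrite addr_ge0 ?divr_ge0 ?mulr_ge0 ?ltW.
  rewrite natrM qK.
  have : K ^+ 2 * 4 < l * e ^+ 2 by rewrite -ltr_pdivrMr ?exprn_gt0 // [X in X / _]mulrC.
  move=> Kl; apply: (@le_lt_trans _ _ (K ^+ 2 * l)).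
    by rewrite expr2 -mulrA [leRHS]mulrC ler_wpM2r // ltW.
  apply: (@lt_trans _ _ ((e * l / 2) ^+ 2)).
    rewrite -(@ltr_pM2r _ 4) // mulrAC; have -> : (e * l / 2) ^+ 2 * 4 = l * e ^+ 2 * l by field.
    by rewrite ltr_pM2r.
  have el : 0 < e * l / 2 by rewrite divr_gt0 ?mulr_gt0.
  by rewrite ltr_pXn2r ?nnegrE ?addr_ge0 // ?ltrDr // ltW.
have chrs : (r * s <= ch (Kmk m k))%N.
  rewrite leqNgt; apply/negP => lt; apply: nch; apply/ch_leP; exact: ltnW.
apply: (@le_trans _ _ (r * s)%:R); last by rewrite ler_nat.
rewrite natrM.
(* Rounding [r] costs a factor [1 - e], the choice of [s] a factor [1 - 2 * e], and [Q / K] another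
   [1 - e]. *)
have r1 : (1 - e) * k%:R / K <= r%:R.
  rewrite ler_pdivrMr//.
  have : K < k%:R * e by rewrite -ltr_pdivrMr.
  lra.
have s3 : (1 - 2 * e) * Q * l <= s%:R.
  have : 1 < l * (e * Q) by rewrite -ltr_pdivrMr // mulr_gt0 //; lra.
  lra.
have QK : (1 - e) * K <= Q.
  have : 2 < Q * e by rewrite -ltr_pdivrMr.
  by rewrite KQ; lra.
have k0 : 0 <= k%:R :> R by [].
apply: (@le_trans _ _ (((1 - e) * k%:R / K) * ((1 - 2 * e) * Q * l))); last first.
  apply: ler_pM => //; first by rewrite divr_ge0 ?mulr_ge0 //; lra.
  by rewrite !mulr_ge0 //; lra.
have -> : (1 - e) * k%:R / K * ((1 - 2 * e) * Q * l) =
  ((1 - e) * (1 - 2 * e) * (Q / K)) * (k%:R * l) by field; lra.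
apply: ler_wpM2r; first by rewrite mulr_ge0 // ltW.
apply: (@le_trans _ _ ((1 - e) * (1 - 2 * e) * (1 - e))); first by nra.
apply: ler_wpM2l; first by rewrite mulr_ge0; lra.
by rewrite ler_pdivlMr.
Qed.

(** * The upper bound *)

Lemma leq_mulS_exp4_exp9 (j : nat) : (j.+1 * 4 ^ j <= 9 ^ j)%N.
Proof. by elim: j => // j IH; rewrite !expnS; nia. Qed.

Lemma leq_exp3_exp4 (j : nat) : (3 ^ j <= 4 ^ j)%N.
Proof. by case: j => // j; rewrite leq_exp2r. Qed.

(** The split into [q] single classes, each content with one color per list; a list misses its part
    with probability [(1 - 1 / q) ^ t]. *)
Lemma Kmk_choosable_class_union (R : realType) (m q t : nat) :
  (0 < q)%N -> (q * m)%:R * expR (- (t%:R / q%:R)) < 1 :> R ->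
  choosable (Kmk m q) t.
Proof.
move=> q0 lt; rewrite -[q in Kmk m q]muln1.
apply: (@choosable_split R _ _ _ 0 _ 0); rewrite ?lexx ?ler01 //.
  exact: Kmk1_choosable.
rewrite muln1 expr0; apply: le_lt_trans lt; apply: ler_wpM2l => //.
rewrite -mulrN expRM_natl; apply: lerXn2r; rewrite ?nnegrE ?expR_ge0 ?divr_ge0 //.
  by rewrite addr0.
apply: le_trans (expR_ge1Dx _); rewrite addr0 -subn1 natrB //.
have q0' : 0 < q%:R :> R by rewrite ltr0n.
by rewrite mulrBl divff ?mul1r // gt_eqF.
Qed.

Lemma Kmk_choosable_exp4 (R : realType) (m q D H j : nat) (l : R) :
  m%:R = expR l -> (4 <= m)%N -> (q <= m)%N -> (0 < D)%N -> (0 < H)%N ->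
  3 * l < D%:R / (128 * H.+1%:R) -> choosable (Kmk m q) (D * H) ->
  choosable (Kmk m (4 ^ j * q)) (D * (4 ^ j * H.+1 - 3 ^ j)).
Proof.
move=> ml m4 qm D0 H0 lD base; elim: j => [|j IH].
  by rewrite !expn0 !mul1n subn1.
have ba := leq_exp3_exp4 j.
have a0 : (0 < 4 ^ j)%N by rewrite expn_gt0.
set s := (D * (4 ^ j * H.+1 - 3 ^ j))%N in IH.
have s0 : (0 < s)%N.
  by rewrite muln_gt0 D0 subn_gt0 (leq_ltn_trans ba) // ltn_Pmulr.
set t := (D * (4 ^ j.+1 * H.+1 - 3 ^ j.+1))%N.
pose a : R := 4 ^+ j; pose b : R := 3 ^+ j; pose h : R := H.+1%:R.
have sE : s%:R = D%:R * (a * h - b) :> R.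
  rewrite natrM natrB ?natrM ?natrX //.
  by rewrite (leq_trans ba) // leq_pmulr.
have tE : t%:R = D%:R * (4 * a * h - 3 * b) :> R.
  rewrite natrM natrB ?natrM ?natrX -?exprS //.
  by rewrite (leq_trans (leq_exp3_exp4 _)) // leq_pmulr.
have ja : j.+1%:R * a <= b ^+ 2.
  have := leq_mulS_exp4_exp9 j; rewrite -(ler_nat R) natrM !natrX /a /b -exprM mulnC exprM.
  by congr (_ <= _ ^+ _); ring.
have ab : b <= a by rewrite /a /b -!natrX ler_nat.
have a1 : 1 <= a by rewrite /a -natrX ler1n.
have b0 : 0 < b by rewrite exprn_gt0.
have h1 : 1 <= h by rewrite ler1n.
rewrite expnS -mulnA.
rewrite -/h in lD; clearbody t s a b h => {a0}.
have D0' : 0 < D%:R :> R by rewrite ltr0n.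
(* With weight [1 - y], the margin [t / 4 - s = D * b / 4] gains [D * y * b / 4] in the exponent,
   and the second-order loss [2 * y ^+ 2 * s] is at most half of that. *)
pose y := b / (a * (16 * h)).
have ah0 : 0 < a * (16 * h) by rewrite !mulr_gt0 //; lra.
have yE : y * (a * (16 * h)) = b by rewrite mulfVK // gt_eqF.
have y0 : 0 <= y by rewrite divr_ge0 // ltW.
have y1 : y <= 1 / 16.
  rewrite ler_pdivrMr //; apply: le_trans ab _.
  have -> : 1 / 16 * (a * (16 * h)) = a * h by field.
  by rewrite ler_peMr //; lra.
have yb : y * b * (16 * h) >= j.+1%:R.
  rewrite /y; have -> : b / (a * (16 * h)) * b * (16 * h) = b ^+ 2 / a by field; lra.
  by rewrite ler_pdivlMr //; lra.
clearbody y.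
(* The split keeps one color more than its threshold, which is thus the predecessor of the list
   size. *)
case: s s0 IH sE => // s _ IH sE.
apply: (@choosable_split R _ _ _ s _ (1 - y)) => //; first lra.
apply: (@lt_le_trans _ _ (expR (- ((y + 2 * y ^+ 2) * s.+1%:R)))); last first.
  rewrite -mulNr mulrC expRM_natl; apply: (@le_trans _ _ ((1 - y) ^+ s.+1)).
    apply: lerXn2r; rewrite ?nnegrE ?expR_ge0 //; first lra.
    apply: expR_le_1B_half; lra.
  by apply: ler_wiXn2l => //; lra.
have le1 : ((4.-1%:R + (1 - y)) / 4%:R) ^+ t <= expR (- (y / 4 * t%:R)).
  rewrite -mulNr [X in expR X]mulrC expRM_natl; apply: lerXn2r; rewrite ?nnegrE ?expR_ge0 //.
    by rewrite divr_ge0 //=; lra.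
  by apply: le_trans (expR_ge1Dx _) => /=; lra.
apply: le_lt_trans (ler_wpM2l _ le1) _ => //.
(* Since [4] and [q] are at most [m], there are at most [m ^ (3 * j.+1)] vertices. *)
apply: (@le_lt_trans _ _ (expR (3 * l * j.+1%:R) * expR (- (y / 4 * t%:R)))).
  apply: ler_wpM2r; first exact: expR_ge0.
  have -> : 3 * l * j.+1%:R = (3 * j.+1)%:R * l by rewrite natrM mulrAC.
  rewrite expRM_natl -ml -natrX ler_nat mulnA -expnS.
  apply: (@leq_trans (m ^ j.+1 * m * m)).
    by rewrite leq_mul2r leq_mul ?orbT // leq_exp2r.
  rewrite -!expnSr mulnS -[j.+3]/(3 + j)%N leq_pexp2l ?(leq_trans _ m4) //.
  by rewrite leq_add2l leq_pmull.
rewrite -expRD ltr_expR tE sE.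
have jpos : 0 < j.+1%:R :> R by rewrite ltr0n.
(* The remaining half of the gain outweighs the vertex count; [128] is [8 * 16]. *)
have c1 : 3 * l * j.+1%:R < D%:R * (y * b) / 8.
  apply: (@lt_le_trans _ _ (D%:R / (128 * h) * j.+1%:R)); first by rewrite ltr_pM2r.
  have -> : D%:R / (128 * h) * j.+1%:R = D%:R * (j.+1%:R / (16 * h)) / 8 by field; lra.
  apply: ler_wpM2r; first by rewrite invr_ge0.
  rewrite ler_pM2l // ler_pdivrMr; lra.
have c2 : D%:R * (y * b) = D%:R * (y * (y * (a * (16 * h)))) by rewrite yE.
have c3 : 0 <= D%:R * (y ^+ 2 * b) by rewrite !mulr_ge0 ?sqr_ge0 // ltW.
lra.
Qed.

Lemma ch_upper (R : realType) (e : R) : 0 < e <= 1 ->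
  exists N : nat, forall m k : nat, (N <= m)%N -> (N <= k)%N ->
    (ch (Kmk m k))%:R <= (1 + 9 * e) * (k%:R * ln (m%:R : R)).
Proof.
move=> /andP[e0 e1].
have [H He] := ex_natr_gt _ (1 / e).
have H0 : (0 < H)%N by rewrite -(ltr_nat R); apply: lt_trans He; exact: divr_gt0.
(* More than [Q] starting classes make [D] large enough for the deviation bound, where
   [384 * (H + 1) * H < Q] is used, and make rounding [k] up to [4 ^ j * q] cheap, as
   [1 <= Q * e]. *)
pose Q := (512 * H.+1 ^ 2)%N.
have [N NP] := near_ln_ge _ (4 * Q%:R / e).
exists (N + 4 + Q)%N => m k mN kN.
have m4 : (4 <= m)%N by apply: leq_trans mN; rewrite addnAC leq_addl.
have lQ : 4 * Q%:R / e <= ln (m%:R : R).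
  by apply: NP; apply: leq_trans mN; rewrite -addnA leq_addr.
have ml : m%:R = expR (ln (m%:R : R)).
  by rewrite lnK // posrE ltr0n (leq_trans _ m4).
move: (ln _) lQ ml => l lQ ml.
have Qk : (Q <= k)%N by apply: leq_trans kN; rewrite leq_addl.
have Q0 : (0 < Q)%N by rewrite muln_gt0 expn_gt0.
have HQ : Q%:R = 512 * (H%:R + 1) ^+ 2 :> R by rewrite natrM natrX natr1.
clearbody Q.
(* Taking [j] as the integer logarithm of [k / Q] to base 4 keeps [q] between [Q] and [4 * Q] for
   every [k]. *)
have [j [Qj jQ]] : exists j, (Q <= k %/ 4 ^ j)%N /\ (k %/ 4 ^ j < 4 * Q)%N.
  have kQ0 : (0 < k %/ Q)%N by rewrite divn_gt0.
  have /andP[j1 j2] := @trunc_log_bounds 4 (k %/ Q) isT kQ0.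
  exists (trunc_log 4 (k %/ Q)); split.
    by rewrite leq_divRL ?expn_gt0 // mulnC -leq_divRL.
  by rewrite ltn_divLR ?expn_gt0 // mulnAC -expnS -ltn_divLR.
pose q := (k %/ 4 ^ j).+1.
have qQ : (q <= 4 * Q)%N by [].
have Qq : (Q < q)%N by [].
have kq : (k <= 4 ^ j * q)%N by rewrite mulnC ltnW // ltn_ceil // expn_gt0.
have qk : (4 ^ j * q <= k + 4 ^ j)%N by rewrite mulnS addnC leq_add2r mulnC leq_divM.
have aQ : (4 ^ j * Q <= k)%N by rewrite mulnC -leq_divRL ?expn_gt0.
clearbody q.
have H0r : 0 < H%:R :> R by rewrite ltr0n.
have eH : 1 < H%:R * e by rewrite -ltr_pdivrMr.
have q0 : 0 < q%:R :> R by rewrite ltr0n (leq_trans _ Qq).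
have Q0r : 0 < Q%:R :> R by rewrite ltr0n.
have l4 : 4 * Q%:R <= l * e by rewrite -ler_pdivrMr.
have l0 : 0 < l.
  by rewrite -(pmulr_lgt0 _ e0); apply: lt_le_trans l4; rewrite mulr_gt0.
have qel : q%:R <= l * e.
  by apply: le_trans l4; rewrite -natrM ler_nat.
have qe : q%:R < expR (e * l).
  apply: lt_le_trans (expR_ge1Dx _); rewrite mulrC; lra.
have qm : (q <= m)%N.
  rewrite -(ler_nat R) ml; apply: le_trans (ltW qe) _; rewrite ler_expR.
  by rewrite ler_piMl // ltW.
(* [D = d.+1] is the least integer with [D * H] above [(1 + e) * q * l], the list size that the base
   case needs. *)
have [d /andP[d1 d2]] : exists d : nat, d%:R <= (1 + e) * q%:R * l / H%:R < d%:R + 1.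
  by apply: ex_natr_itv; rewrite divr_ge0 // !mulr_ge0 ?addr_ge0 // ltW.
have dH : (1 + e) * q%:R * l < d.+1%:R * H%:R by rewrite -ltr_pdivrMr // -natr1.
have base : choosable (Kmk m q) (d.+1 * H).
  apply: (@Kmk_choosable_class_union R); first by rewrite (leq_trans _ Qq).
  apply: (@lt_le_trans _ _ (expR (e * l) * (expR l * expR (- ((1 + e) * l))))); last first.
    by rewrite -!expRD -[leRHS]expR0 ler_expR; lra.
  rewrite natrM -mulrA -ml; apply: ltr_pM => //; rewrite ?mulr_ge0 ?expR_ge0 //.
  rewrite ltr_pM2l ?ml ?expR_gt0 // ltr_expR ltrN2 ltr_pdivlMr //.
  by rewrite natrM mulrAC.
have step : 3 * l < d.+1%:R / (128 * H.+1%:R).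
  rewrite ltr_pdivlMr; last by rewrite mulr_gt0.
  rewrite -(ltr_pM2r H0r); apply: lt_trans dH.
  have -> : 3 * l * (128 * H.+1%:R) * H%:R = (384 * (H%:R + 1) * H%:R) * l.
    by rewrite -natr1; ring.
  rewrite ltr_pM2r //; apply: (@lt_trans _ _ q%:R); last first.
    by rewrite ltr_pMl // ltrDl.
  apply: (@lt_trans _ _ Q%:R); last by rewrite ltr_nat.
  by rewrite HQ; nra.
have := Kmk_choosable_leq _ _ _ _ kq
  (@Kmk_choosable_exp4 R m q d.+1 H j l ml m4 qm (ltn0Sn d) H0 step base).
move=> /ch_leP; rewrite -(ler_nat R) => /le_trans; apply.
have qkr : (4 ^ j)%:R * q%:R <= k%:R * (1 + e) :> R.
  rewrite -natrM; apply: (@le_trans _ _ (k + 4 ^ j)%:R); first by rewrite ler_nat.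
  rewrite natrD mulrDr mulr1 lerD2l.
  apply: (@le_trans _ _ ((4 ^ j)%:R * Q%:R * e)).
    rewrite -mulrA ler_peMr // HQ; nra.
  by rewrite ler_pM2r // -natrM ler_nat.
apply: (@le_trans _ _ (d.+1 * (4 ^ j * H.+1))%:R).
  by rewrite ler_nat leq_mul2l leq_subr orbT.
rewrite 2!natrM -[d.+1%:R]natr1 -[H.+1%:R]natr1.
set a := (4 ^ j)%:R in qkr *.
have a0 : 0 <= a by [].
clearbody a.
(* Absorbs the rounding up of [D]. *)
have hl : H%:R + 1 <= e * l * q%:R.
  apply: (@le_trans _ _ Q%:R); first by rewrite HQ; nra.
  apply: (@le_trans _ _ (l * e)); first by lra.
  rewrite mulrC ler_peMr ?ler1n ?(leq_trans _ Qq) //.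
  by rewrite mulr_ge0 // ltW.
have Hle : (H%:R + 1) / H%:R <= 1 + e by rewrite ler_pdivrMr //; lra.
have d3 : (d%:R + 1) * (H%:R + 1) <= ((1 + e) ^+ 2 + e) * (q%:R * l).
  rewrite mulrDl mul1r.
  have : d%:R * (H%:R + 1) <= (1 + e) ^+ 2 * (q%:R * l).
    apply: (@le_trans _ _ ((1 + e) * q%:R * l / H%:R * (H%:R + 1))).
      by rewrite ler_wpM2r // addr_ge0.
    have -> : (1 + e) * q%:R * l / H%:R * (H%:R + 1) =
      ((1 + e) * (q%:R * l)) * ((H%:R + 1) / H%:R) by field; lra.
    have -> : (1 + e) ^+ 2 * (q%:R * l) = (1 + e) * (q%:R * l) * (1 + e) by ring.
    by rewrite ler_wpM2l // !mulr_ge0 ?addr_ge0 // ltW.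
  lra.
rewrite mulrCA; apply: le_trans (ler_wpM2l a0 d3) _.
have -> : a * (((1 + e) ^+ 2 + e) * (q%:R * l)) = ((1 + e) ^+ 2 + e) * l * (a * q%:R) by ring.
have p0 : 0 <= ((1 + e) ^+ 2 + e) * l.
  by rewrite mulr_ge0 ?addr_ge0 ?sqr_ge0 // ltW.
apply: le_trans (ler_wpM2l p0 qkr) _.
have -> : ((1 + e) ^+ 2 + e) * l * (k%:R * (1 + e)) =
  (((1 + e) ^+ 2 + e) * (1 + e)) * (k%:R * l) by ring.
apply: ler_wpM2r; first by rewrite mulr_ge0 // ltW.
(* The factor expands to [1 + 4 * e + 4 * e ^+ 2 + e ^+ 3]. *)
have e2 : e ^+ 2 <= e by rewrite expr2 ler_piMr // ltW.
have e3 : e ^+ 2 * e <= e by apply: le_trans e2; rewrite ler_piMr ?sqr_ge0.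
lra.
Qed.

Theorem theorem3p1 (R : realType) (eps : R) (heps : 0 < eps) :
  exists N : nat, forall m k : nat, (N <= m)%N -> (N <= k)%N ->
    (1 - eps) * (k%:R * ln (m%:R : R)) <= (ch (Kmk m k))%:R /\
    (ch (Kmk m k))%:R <= (1 + eps) * (k%:R * ln (m%:R : R)).
Proof.
(* The losses are [4 * e] below and [9 * e] above; the cap [1 / 4] is the range of [ch_lower]. *)
pose e := Num.min (eps / 9) (1 / 4).
have [e0 e9 e4] : [/\ 0 < e, e <= eps / 9 & e <= 1 / 4].
  by rewrite /e lt_min !ge_min !lexx orbT !divr_gt0.
clearbody e.
have [|N1 lower] := @ch_lower R e; first by rewrite e0.
have [|N2 upper] := @ch_upper R e; first by rewrite e0; lra.
exists (N1 + N2).+1 => m k mN kN.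
have kl : 0 <= k%:R * ln (m%:R : R).
  by rewrite mulr_ge0 // ln_ge0 // ler1n (leq_trans _ mN).
split.
  apply: le_trans (lower m k _ _); [|lia|lia].
  by apply: ler_wpM2r => //; lra.
apply: le_trans (upper m k _ _) _; [lia|lia|].
by apply: ler_wpM2r => //; lra.
Qed.
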